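(* If a strongly star-$\epsilon$-space $X$ is the union of less than $\mathrm{cov}(\mathcal{M})$ many $S_1(\Omega,\Gamma)$ spaces, then $X$ is strongly star-Rothberger.
   Context: A space is a topological space. $\mathrm{cov}(\mathcal{M})$ is the minimum cardinality of a family of meager subsets of $\mathbb{R}$ that covers $\mathbb{R}$; equivalently, the minimum cardinality of a set $F\subseteq\mathbb{N}^{\mathbb{N}}$ such that for every $g\in\mathbb{N}^{\mathbb{N}}$ there is an $f\in F$ with $f(n)\neq g(n)$ for all but finitely many $n$. An open cover $\mathcal{U}$ of a space $Z$ is an $\omega$-cover if $Z\notin\mathcal{U}$ and for each finite subset $F$ of $Z$ there is a $U\in\mathcal{U}$ with $F\subseteq U$; it is a $\gamma$-cover if it is infinite and each point of $Z$ fails to belong to at most finitely many members of $\mathcal{U}$. $\Omega$ and $\Gamma$ denote the collections of all $\omega$-covers and all $\gamma$-covers, respectively. $Z$ is an $S_1(\Omega,\Gamma)$ space if for each sequence $(\mathcal{U}_n)_{n\in\mathbb{N}}$ of $\omega$-covers of $Z$ there is a sequence $(V_n)$ with $V_n\in\mathcal{U}_n$ for each $n$ such that $\{V_n : n\in\mathbb{N}\}$ is a $\gamma$-cover of $Z$. For $x\in X$ and a collection $\mathcal{P}$ of subsets of $X$, $St(x,\mathcal{P})=\bigcup\{B\in\mathcal{P} : x\in B\}$. A space $X$ is a strongly star-$\epsilon$-space if for every open cover $\mathcal{U}$ of $X$ there is a countable set $A\subseteq X$ such that $\{St(x,\mathcal{U}) : x\in A\}$ is an $\omega$-cover of $X$.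 $X$ is strongly star-Rothberger if for each sequence $(\mathcal{U}_n)_{n\in\mathbb{N}}$ of open covers of $X$ there is a sequence $(x_n)$ of points of $X$ such that $\{St(x_n,\mathcal{U}_n) : n\in\mathbb{N}\}$ is an open cover of $X$. The spaces whose union is $X$ are subspaces of $X$. *)

(* Defs.v *)
From HB Require Import structures.
From mathcomp Require Import all_boot all_order all_algebra.
From mathcomp Require Import all_classical all_reals all_analysis.
Import numFieldNormedType.Exports.

Set Implicit Arguments.
Unset Strict Implicit.
Unset Printing Implicit Defensive.

Local Open Scope classical_set_scope.
Local Open Scope card_scope.

Definition card_lt {S T : Type} (A : set S) (B : set T) : Prop :=
  A #<= B /\ ~ (B #<= A).

Definition nowhere_dense (T : topologicalType) (A : set T) : Prop :=
  (closure A)° = set0.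

Definition meager (T : topologicalType) (A : set T) : Prop :=
  exists2 N : nat -> set T,
    forall n, nowhere_dense (N n) & A = \bigcup_n N n.

Definition meager_covering (T : topologicalType) (C : set (set T)) : Prop :=
  C `<=` @meager T /\ \bigcup_(M in C) M = setT.

(* A covering family realizing the minimum that defines cov(M). *)
Definition realizes_covM (R : realType) (C : set (set R)) : Prop :=
  meager_covering C /\
  forall D : set (set R), meager_covering D -> C #<= D.

Definition card_lt_covM (R : realType) (T : Type) (A : set T) : Prop :=
  exists2 C : set (set R), realizes_covM C & card_lt A C.

Definition open_cover (Z : topologicalType) (U : set (set Z)) : Prop :=
  U `<=` open /\ \bigcup_(V in U) V = setT.

Definition captures_finite (Z : Type) (U : set (set Z)) : Prop :=
  forall F : set Z, finite_set F -> exists2 V, U V & F `<=` V.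

Definition omega_cover (Z : topologicalType) (U : set (set Z)) : Prop :=
  [/\ open_cover U, ~ U setT & captures_finite U].

Definition gamma_cover (Z : topologicalType) (U : set (set Z)) : Prop :=
  [/\ open_cover U, infinite_set U &
      forall z : Z, finite_set [set V | U V /\ ~ V z]].

Definition S1_Omega_Gamma (Z : topologicalType) : Prop :=
  forall U : nat -> set (set Z), (forall n, omega_cover (U n)) ->
  exists2 V : nat -> set Z,
    forall n, U n (V n) & gamma_cover (range V).

Definition star (X : Type) (x : X) (P : set (set X)) : set X :=
  \bigcup_(B in [set B | P B /\ B x]) B.

(* The clause "X is not a member" of omega_cover is not imposed on the family
   of stars: if U is the cover {X} then every star is X, so no space at all
   would satisfy the definition.  It is imposed on the covers occurring in
   S1_Omega_Gamma. *)
Definition strongly_star_epsilon (X : topologicalType) : Prop :=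
  forall U : set (set X), open_cover U ->
  exists A : set X,
    [/\ countable A,
        open_cover [set star x U | x in A] &
        captures_finite [set star x U | x in A]].

Definition strongly_star_Rothberger (X : topologicalType) : Prop :=
  forall U : nat -> set (set X), (forall n, open_cover (U n)) ->
  exists x : nat -> X, open_cover (range (fun n => star (x n) (U n))).

(* Main.v *)
Require Import Defs.
From mathcomp Require Import all_boot all_order all_algebra.
From mathcomp Require Import all_classical all_reals all_analysis.
From mathcomp Require Import lra.
Import Order.TTheory GRing.Theory Num.Theory.
Import numFieldNormedType.Exports.

(** Enumerate, for each cover [U n], countably many stars capturing all finite
    sets.  For a piece [Y] of the union, these stars either cover [Y] outright
    for infinitely many [n], or their traces on [Y] are eventually omega-covers,
    so that S1(Omega, Gamma) applies; in both cases there is an infinite set [D]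
    of indices and a choice [f] of stars on [D] such that every point of [Y]
    lies in the star chosen at [n] for all but finitely many [n] in [D].  It
    suffices to find a single sequence [g] agreeing infinitely often with each
    of these fewer than cov(M) partial functions.  Assign to each real [r] the
    sequence [n |-> code n r], where [code n] takes every value on an open
    subinterval of every interval of length greater than [2 / n].  The reals
    whose sequence agrees with [f] only finitely often on [D] form a meager
    set, and fewer than cov(M) meager sets do not cover the line. *)

Local Open Scope classical_set_scope.

Lemma infinite_set_nat_ge (D : set nat) (m : nat) :
  ~ finite_set D -> exists2 n, D n & (m <= n)%N.
Proof.
move=> Dinf; apply: contrapT => nD; apply: Dinf.
apply: (@sub_finite_set _ _ `I_m); last exact: finite_II.
move=> n Dn /=; rewrite ltnNge; apply/negP => mn.
by apply: nD; exists n.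
Qed.

Lemma finite_set_nat_ub (D : set nat) :
  finite_set D -> exists m, forall n, D n -> (n < m)%N.
Proof.
move=> /finite_seqP[s ->]; exists (\max_(i <- s) i).+1 => n /= ns.
by rewrite ltnS; exact: (leq_bigmax_seq (F := id)).
Qed.

Lemma infinite_range_inj (T : Type) (V : nat -> T) :
  ~ finite_set (range V) ->
  exists D : set nat, ~ finite_set D /\ {in D &, injective V}.
Proof.
(* Keep the first index of each value of [V]. *)
move=> Vinf; pose D := [set n | forall m, (m < n)%N -> V m <> V n].
exists D; split.
  move=> Dfin; apply: Vinf.
  apply: (@sub_finite_set _ _ (V @` D)); last exact: finite_image.
  move=> _ [n _ <-]; elim/ltn_ind: n => n IH.
  have [Dn|/existsNP[m /not_implyP[mn /contrapT <-]]] := pselect (D n).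
    by exists n.
  exact: IH.
move=> i j /set_mem Di /set_mem Dj Vij.
by have [ij|ji|//] := ltngtP i j; [case: (Dj _ ij)|case: (Di _ ji)].
Qed.

Section generic_sequences.
Variable R : realType.
Local Open Scope ring_scope.

(** With [t] the fractional part of [n%:R * r], the value is [k] whenever [1/(k+2) < t < 1/(k+1)].
    So for [n > 0] every natural number is taken on an open interval inside each period of length
    [1/n]. *)
Definition code (n : nat) (r : R) : nat :=
  (Num.truncn ((n%:R * r - (Num.floor (n%:R * r))%:~R)^-1)).-1.

Lemma code_eq (n k : nat) (m : int) (r : R) :
  m%:~R + k.+2%:R^-1 < n%:R * r < m%:~R + k.+1%:R^-1 -> code n r = k.
Proof.
rewrite /code; move: (n%:R * r) => x /andP[lx xl].
have k0 : 0 < k.+2%:R^-1 :> R by rewrite invr_gt0 ltr0n.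
have k1 : k.+1%:R^-1 <= 1 :> R by rewrite invf_le1 ?ler1n ?ltr0n.
have d0 : m%:~R < x by rewrite (lt_trans _ lx)// ltrDl.
rewrite (floor_def (m := m)); last first.
  by rewrite intrD ltW//= (lt_le_trans xl)// lerD2l.
rewrite (truncn_def (n := k.+1))//; apply/andP; split.
  by rewrite -[leLHS]invrK lef_pV2 ?posrE ?subr_gt0 ?invr_gt0 ?ltr0n// ltW// ltrBlDl.
by rewrite -[ltRHS]invrK ltf_pV2 ?posrE ?subr_gt0// ltrBrDl.
Qed.

(** The interval []a, b[] lies in the same period [[m/n, (m+1)/n]] as [x], whose length is less than
    [e/2]. *)
Lemma code_ball (x e : R) (n k : nat) : 0 < e -> 2 < n%:R * e ->
  exists2 J : set R, [/\ open J, J !=set0 & J `<=` ball x e] &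
    forall r, J r -> code n r = k.
Proof.
move=> e0 ne; have n0 : 0 < n%:R :> R by nra.
pose m := Num.floor (n%:R * x).
pose a := (m%:~R + k.+2%:R^-1) / n%:R : R.
pose b := (m%:~R + k.+1%:R^-1) / n%:R : R.
have /andP[mx xm] : m%:~R <= n%:R * x < m%:~R + 1.
  by have := floor_itv (n%:R * x); rewrite intrD mulr1z.
have k1 : k.+1%:R^-1 <= 1 :> R by rewrite invf_le1 ?ler1n ?ltr0n.
have k2 : 0 < k.+2%:R^-1 :> R by rewrite invr_gt0 ltr0n.
have k12 : k.+2%:R^-1 < k.+1%:R^-1 :> R.
  by rewrite ltf_pV2 ?posrE ?ltr0n// ltr_nat.
have ab : a < b by rewrite /a /b ltr_pM2r ?invr_gt0// ltrD2l.
exists `]a, b[%classic.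
  split; first exact: itv_open.
    by exists ((a + b) / 2); rewrite /= in_itv/= !midf_lt.
  move=> r /=; rewrite in_itv/= /a /b ltr_pdivrMr// ltr_pdivlMr// => /andP[ar rb].
  rewrite -ball_normE /= -(@ltr_pM2l _ n%:R)// -[X in X * `|_|]gtr0_norm// -normrM.
  move: k.+1%:R^-1 k.+2%:R^-1 ar rb k1 k2 => v u ur rv v1 u0.
  by rewrite ltr_norml; apply/andP; split; nra.
move=> r /=; rewrite in_itv/= /a /b ltr_pdivrMr// ltr_pdivlMr// => /andP[ar rb].
by apply: (@code_eq _ _ m); rewrite (mulrC n%:R) ar rb.
Qed.

(** A ball inside the closure would contain, for some large [n] in [D], a nonempty open set on which
    [code n] equals [f n], hence disjoint from the set. *)
Lemma nowhere_dense_code (D : set nat) (f : nat -> nat) (m : nat) :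
  ~ finite_set D ->
  nowhere_dense [set r : R | forall n, D n -> (m <= n)%N -> code n r <> f n].
Proof.
move=> Dinf; apply: contrapT => /eqP/set0P[x].
move=> /nbhs_ballP[e /= e0 xe].
have [n Dn mn] := infinite_set_nat_ge D (maxn m (Num.truncn (2 / e)).+1) Dinf.
have ne : 2 < n%:R * e.
  rewrite -ltr_pdivrMr//.
  have /andP[_ h] : (Num.truncn (2 / e))%:R <= 2 / e < (Num.truncn (2 / e)).+1%:R.
    by apply: truncn_itv; rewrite divr_ge0// ltW.
  apply: (lt_le_trans h); rewrite ler_nat; exact: leq_trans (leq_maxr _ _) mn.
have [J [Jo [y Jy] Jxe] Jf] := code_ball x e n (f n) e0 ne.
have [z [/= zf Jz]] := xe _ (Jxe _ Jy) J (open_nbhs_nbhs (conj Jo Jy)).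
exact: zf _ Dn (leq_trans (leq_maxl _ _) mn) (Jf _ Jz).
Qed.

(** Otherwise the meager sets [M t] would cover the line, and minimality of [C] would give
    [C #<= F]. *)
Lemma card_lt_covM_guess (T : Type) (F : set T) (D : T -> set nat)
    (f : T -> nat -> nat) :
  card_lt_covM R F -> (forall t, F t -> ~ finite_set (D t)) ->
  exists g : nat -> nat,
    forall t, F t -> forall m, exists n, [/\ D t n, (m <= n)%N & g n = f t n].
Proof.
move=> [C [_ Cmin] [_ nCF]] Dinf.
pose N t m := [set r : R | forall n, D t n -> (m <= n)%N -> code n r <> f t n].
pose M t := \bigcup_m N t m.
have /existsNP[r Mr] : ~ (forall r, exists2 t, F t & M t r).
  move=> Mcov; apply: nCF.
  apply: (card_le_trans _ (card_image_le M F)); apply: Cmin; split.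
    move=> _ [t Ft <-]; exists (N t) => // m.
    exact/nowhere_dense_code/Dinf.
  rewrite -subTset => r _; have [t Ft Mtr] := Mcov r.
  by exists (M t) => //; exists t.
exists (code^~ r) => t Ft m; apply: contrapT => nex; apply: Mr.
exists t => //; exists m => // n Dn mn gn.
by apply: nex; exists n.
Qed.

End generic_sequences.

Lemma S1_Omega_Gamma_select (X : topologicalType) (Y : set X)
    (W : nat -> nat -> set X) :
  S1_Omega_Gamma (set_type Y) ->
  (forall n k, open (W n k)) ->
  (forall n (G : set X), finite_set G -> exists k, G `<=` W n k) ->
  exists (D : set nat) (f : nat -> nat), ~ finite_set D /\
    forall y, Y y -> finite_set [set n | D n /\ ~ W n (f n) y].
Proof.
move=> S1Y Wo Wfin.
pose E := [set n | exists k, Y `<=` W n k].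
have [/(finite_set_nat_ub _)[m Em]|Einf] := pselect (finite_set E); last first.
  have /choice[f Ef] n : exists k, E n -> Y `<=` W n k.
    by have [[k Yk]|nE] := pselect (E n); [exists k|exists 0%N].
  exists E, f; split => // y Yy; apply: (sub_finite_set _ (finite_set0 nat)).
  by move=> n [En] /=; apply; exact: Ef.
pose incl : set_type Y -> X := set_val.
(* Past the bound [m] of [E] no [W n k] contains [Y], so no trace is the whole space, as an
   omega-cover demands. *)
pose U n := range (fun k => incl @^-1` W (m + n)%N k).
have Uomega n : omega_cover (U n).
  have Ucap : captures_finite (U n).
    move=> G Gfin; have [k Gk] := Wfin (m + n)%N _ (finite_image incl Gfin).
    exists (incl @^-1` W (m + n)%N k); first by exists k.
    by move=> y Gy; apply: Gk; exists y.
  split=> //.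
    split.
      move=> _ [k _ <-]; move/continuousP: (@initial_continuous _ _ incl).
      by apply; exact: Wo.
    rewrite -subTset => y _; have [V UV yV] := Ucap [set y] (finite_set1 y).
    by exists V => //; exact: yV.
  move=> [k _ kT]; suff /Em : E (m + n)%N by rewrite ltnNge leq_addr.
  exists k => y Yy.
  by have : (incl @^-1` W (m + n)%N k) (exist _ y (mem_set Yy)) by rewrite kT.
have [V UV [_ Vinf Vfin]] := S1Y U Uomega.
have /choice[h Vh] n : exists k, V n = incl @^-1` W (m + n)%N k.
  by have [k _ <-] := UV n; exists k.
(* [range V] being a gamma-cover does not prevent one member that misses a point
   from being repeated infinitely often, so repetitions are discarded. *)
have [D [Dinf Dinj]] := infinite_range_inj _ V Vinf.
exists (addn m @` D), (fun n => h (n - m)%N); split.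
  move=> mD; apply: Dinf.
  apply: (sub_finite_set _ (finite_image (fun n => (n - m)%N) mD)).
  by move=> n Dn; exists (m + n)%N; [exists n|rewrite addKn].
move=> y Yy; pose z : set_type Y := exist _ y (mem_set Yy).
suff : finite_set [set n | D n /\ ~ V n z].
  move=> /(finite_image (addn m)); apply: sub_finite_set.
  move=> _ [[n Dn <-]]; rewrite addKn => nW; exists n => //; split=> //.
  by rewrite Vh.
(* Off [D] the value [setT] contains [z], so the preimage below meets only indices in [D], where [V]
   is injective. *)
pose V' n := if n \in D then V n else setT.
apply: (@sub_finite_set _ _ (V' @^-1` [set A | range V A /\ ~ A z])).
  by move=> n [Dn nVz]; rewrite /V' /= mem_set//; split=> //; exists n.
apply: finite_preimage (Vfin z) => i j; rewrite !inE /V' => -[_ +] [_ +].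
case: ifPn => [iD _|_ /(_ I)//]; case: ifPn => [jD _|_ /(_ I)//].
exact: Dinj.
Qed.

Theorem theorem4p17 (R : realType) (X : topologicalType)
    (hX : strongly_star_epsilon X)
    (F : set (set X)) (hF : card_lt_covM R F)
    (hS1 : forall Y : set X, F Y -> S1_Omega_Gamma (set_type Y))
    (hcov : \bigcup_(Y in F) Y = setT) :
  strongly_star_Rothberger X.
Proof.
move=> U Ucov.
have star_open n x : open (star x (U n)).
  by apply: bigcup_open => B [UB _]; have [+ _] := Ucov n; exact.
have /choice[e estar] n : exists e : nat -> X, forall G : set X, finite_set G ->
    exists k, G `<=` star (e k) (U n).
  have [A [cA _ Acap]] := hX _ (Ucov n).
  have [_ [a Aa _] _] := Acap _ (finite_set0 X).
  have /countable_injP[/= h hinj] := cA.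
  (* [e k] is the point of [A] that the injection [h] numbers [k], or the default [a] if there is
     none. *)
  exists (fun k => xget a [set x | A x /\ h x = k]) => G /Acap[_ [x Ax <-] Gx].
  exists (h x); suff -> : xget a [set x' | A x' /\ h x' = h x] = x by [].
  case: xgetP => [y _ [Ay hyx]|/(_ x)]; last by case.
  by apply: hinj => //; exact: mem_set.
pose W n k := star (e n k) (U n).
have /choice[D /choice[f Df]] Y : exists (D : set nat) (f : nat -> nat), F Y ->
    ~ finite_set D /\ forall y, Y y -> finite_set [set n | D n /\ ~ W n (f n) y].
  have [FY|nFY] := pselect (F Y); last by exists set0, id.
  have [D [f Df]] := @S1_Omega_Gamma_select X Y W (hS1 _ FY)
    (fun n k => star_open n (e n k)) estar.
  by exists D, f.
have [g gf] := @card_lt_covM_guess R _ F D f hF (fun Y FY => (Df Y FY).1).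
exists (fun n => e n (g n)); split; first by move=> _ [n _ <-].
rewrite -subTset => y _.
have [Y FY Yy] : (\bigcup_(Y in F) Y) y by rewrite hcov.
have [m mlt] := finite_set_nat_ub _ ((Df Y FY).2 y Yy).
have [n [Dn mn gn]] := gf Y FY m.
exists (W n (f Y n)); first by exists n => //; rewrite gn.
by apply: contrapT => nW; move: (mlt n (conj Dn nW)); rewrite ltnNge mn.
Qed.
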